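(* Let $G$ be a finite simple graph without isolated vertices, with vertices $v_1,\ldots,v_n$, edge set $\mathcal{E}(G)$ and vertex degrees $d_1,\ldots,d_n$. Then $$s_Q(G)^2\ \ge\ \frac{4}{\left(\sum_{i=1}^n d_i^{-2}\right)^2}\left(\sum_{i=1}^n d_i^{-2}\,\sum_{j=1}^n\Big(1+\sum_{k:\,v_jv_k\in\mathcal{E}(G)}d_k^{-1}\Big)^2-\left(\sum_{i=1}^n\Big(d_i^{-1}+\sum_{k:\,v_iv_k\in\mathcal{E}(G)}(d_id_k)^{-1}\Big)\right)^2\right).$$
   Context: For a finite simple graph $G$ on $n$ vertices, let $A_G$ be its adjacency matrix and $D_G$ the diagonal matrix of vertex degrees. The signless Laplacian matrix is $Q_G=D_G+A_G$ with eigenvalues $q_1\ge q_2\ge\cdots\ge q_n$, and the signless Laplacian spread is $s_Q(G)=q_1-q_n$. *)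

(* Defs.v *)
From mathcomp Require Import all_boot all_order all_algebra.
From mathcomp Require Import polyrcf complex.

Set Implicit Arguments.
Unset Strict Implicit.
Unset Printing Implicit Defensive.

Import Order.TTheory GRing.Theory Num.Theory.
Local Open Scope ring_scope.

(* A simple graph on the vertices v_1, ..., v_n is a symmetric irreflexive
   e : rel 'I_n; the reals are an arbitrary real closed field R. *)

Definition degree (n : nat) (e : rel 'I_n) (i : 'I_n) : nat :=
  #|[set j | e i j]|.

Definition adjacency_mx (R : rcfType) (n : nat) (e : rel 'I_n) : 'M[R]_n :=
  \matrix_(i, j) (e i j)%:R.

Definition degree_mx (R : rcfType) (n : nat) (e : rel 'I_n) : 'M[R]_n :=
  diag_mx (\row_i (degree e i)%:R).

Definition signless_laplacian (R : rcfType) (n : nat) (e : rel 'I_n) :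
    'M[R]_n :=
  degree_mx R e + adjacency_mx R e.

(* The eigenvalues of A lying in R, repeated according to their multiplicity in
   the characteristic polynomial, largest first. For symmetric A these are all
   n eigenvalues, see char_poly_eigenvalues and size_eigenvalues. *)
Definition eigenvalues (R : rcfType) (n : nat) (A : 'M[R]_n) : seq R :=
  sort >=%R
    (flatten [seq nseq (mup x (char_poly A)) x | x <- rootsR (char_poly A)]).

(* Indices start at 0: with q_1 >= ... >= q_n the eigenvalues, q i is q_(i+1). *)
Definition signless_spread (R : rcfType) (n : nat) (e : rel 'I_n) : R :=
  let q := nth 0 (eigenvalues (signless_laplacian R e)) in q 0%N - q n.-1.

Lemma signless_laplacian_sym (R : rcfType) (n : nat) (e : rel 'I_n) :
  symmetric e -> (signless_laplacian R e)^T = signless_laplacian R e.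
Proof.
move=> e_sym; rewrite linearD /= tr_diag_mx; congr (_ + _).
by apply/matrixP => i j; rewrite !mxE e_sym.
Qed.

Lemma char_poly_conj (F : fieldType) (n : nat) (P D : 'M[F]_n) :
  P \in unitmx -> char_poly (invmx P *m D *m P) = char_poly D.
Proof.
move=> P_unit; rewrite /char_poly /char_poly_mx.
pose Q : 'M[{poly F}]_n := map_mx polyC P.
pose Q' : 'M[{poly F}]_n := map_mx polyC (invmx P).
have Q'Q : Q' *m Q = 1%:M by rewrite -map_mxM mulVmx // map_mx1.
have -> : 'X%:M - map_mx polyC (invmx P *m D *m P)
        = Q' *m ('X%:M - map_mx polyC D) *m Q.
  rewrite mulmxBr mulmxBl !map_mxM; congr (_ - _).
  by rewrite scalar_mxC -mulmxA Q'Q mulmx1.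
by rewrite !det_mulmx mulrAC -det_mulmx Q'Q det1 mul1r.
Qed.

Lemma char_poly_sym_split (R : rcfType) (n : nat) (A : 'M[R]_n) :
  A^T = A -> exists s : seq R, char_poly A = \prod_(x <- s) ('X - x%:P).
Proof.
move=> A_sym.
pose f : {rmorphism R -> R[i]} := real_complex R; pose B := map_mx f A.
have B_herm : B \is hermsymmx.
  apply: realsym_hermsym.
    by apply/is_hermitianmxP; rewrite expr0 scale1r map_mx_id // map_trmx A_sym.
  by apply/mxOverP => i j; rewrite mxE /f /= complex_real.
have /mxOverP D_real := hermitian_spectral_diag_real B_herm.
have /hermitian_normalmx/orthomx_spectralP B_eq := B_herm.
set P := spectralmx B in B_eq; set D := spectral_diag B in B_eq D_real.
have P_unit : P \in unitmx by apply: spectral_unit.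
exists [seq complex.Re (D 0 i) | i <- enum 'I_n].
apply: (map_poly_inj f); rewrite map_char_poly -/B B_eq char_poly_conj //.
rewrite char_poly_trig ?diag_mx_is_trig // rmorph_prod /= big_map big_enum /=.
apply: eq_bigr => i _.
rewrite !mxE eqxx mulr1n rmorphB /= map_polyX map_polyC /=.
by congr (_ - _%:P); rewrite RRe_real.
Qed.

Lemma char_poly_eigenvalues (R : rcfType) (n : nat) (A : 'M[R]_n) :
  A^T = A -> char_poly A = \prod_(x <- eigenvalues A) ('X - x%:P).
Proof.
move=> /char_poly_sym_split[s cA].
have cA0 : char_poly A != 0 by rewrite monic_neq0 ?char_poly_monic.
rewrite [LHS]cA; apply/perm_big; rewrite perm_sym perm_sort.
apply/allP => x _ /=; rewrite count_flatten sumnE !big_map.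
under eq_bigr => y _ do rewrite count_nseq /=.
have mupE : mup x (char_poly A) = count_mem x s by rewrite cA mu_prod_XsubC.
have roots_x : (x \in rootsR (char_poly A)) = root (char_poly A) x.
  by rewrite -roots_on_rootsR // in_itv.
have [x_root | /negP x_root] := boolP (root (char_poly A) x).
  rewrite (bigD1_seq x) ?roots_x ?uniq_roots //= eqxx mul1n mupE big1 ?addn0 //.
  by move=> y /negPf ->.
rewrite -mupE mupNroot; last exact/negP.
apply/eqP; rewrite big_seq big1 // => y y_root.
by case: eqP => // yx; case: x_root; rewrite -roots_x -yx.
Qed.

Lemma size_eigenvalues (R : rcfType) (n : nat) (A : 'M[R]_n) :
  A^T = A -> size (eigenvalues A) = n.
Proof.
move=> /char_poly_eigenvalues/(congr1 (fun p : {poly R} => size p)).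
by rewrite size_char_poly size_prod_XsubC => -[].
Qed.

(* Main.v *)
(* The vector x = (1/d_1, ..., 1/d_n) has Q x = (1 + sum_{k ~ j} 1/d_k)_j. For a
   symmetric matrix A with spectrum in [m, M] the matrix (M - A)(A - m) is
   positive semidefinite, hence
     |x|^2 |A x|^2 - (x.Ax)^2 <= (M |x|^2 - x.Ax) (x.Ax - m |x|^2),
   which is at most ((M - m) |x|^2 / 2)^2 by AM-GM. *)
Require Import Defs.
From mathcomp Require Import all_boot all_order all_algebra.
From mathcomp Require Import complex ring.

Set Implicit Arguments.
Unset Strict Implicit.
Unset Printing Implicit Defensive.

Import Order.TTheory GRing.Theory Num.Theory.
Local Open Scope ring_scope.
Local Open Scope sesquilinear_scope.

Lemma eigenvalues_bounds (R : rcfType) (n : nat) (A : 'M[R]_n) (x : R) :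
    A^T = A -> x \in eigenvalues A ->
  nth 0 (eigenvalues A) n.-1 <= x <= nth 0 (eigenvalues A) 0%N.
Proof.
move=> A_sym x_in.
have s_sorted : sorted >=%R (eigenvalues A).
  by apply: sort_sorted => y z; rewrite orbC; apply: le_total.
have nth_le i j : (j < n)%N -> (i <= j)%N ->
    (eigenvalues A)`_j <= (eigenvalues A)`_i.
  move=> j_lt ij; apply: (sorted_leq_nth ge_trans lexx 0 s_sorted) => //.
    by rewrite inE size_eigenvalues // (leq_ltn_trans ij).
  by rewrite inE size_eigenvalues.
have := x_in; rewrite -index_mem size_eigenvalues // => i_lt.
(* Membership of [x] excludes [n = 0], so [n.-1] is the last valid index and [nth] does not fall
   back on its default. *)
have n_gt0 : (0 < n)%N by apply: leq_trans i_lt.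
rewrite -{1 2}(nth_index 0 x_in).
have last_lt : (n.-1 < n)%N by rewrite prednK.
have idx_le : (index x (eigenvalues A) <= n.-1)%N by rewrite -ltnS prednK.
by rewrite !nth_le.
Qed.

(** Scalar matrices commute with [P], so both factors are conjugates by the same [P]; the inner
    [P *m invmx P] cancels and two diagonal matrices remain. *)
Lemma conjmx_diag_shift_mul (F : fieldType) (n : nat) (P B : 'M[F]_n)
    (d : 'rV[F]_n) (a b : F) :
    P \in unitmx -> B = invmx P *m diag_mx d *m P ->
  (a%:M - B) *m (B - b%:M) =
  invmx P *m diag_mx (\row_i ((a - d 0 i) * (d 0 i - b))) *m P.
Proof.
move=> P_unit B_eq.
have conjC c : c%:M = invmx P *m c%:M *m P.
  by rewrite scalar_mxC -mulmxA mulVmx // mulmx1.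
have -> : a%:M - B = invmx P *m (a%:M - diag_mx d) *m P.
  by rewrite mulmxBr mulmxBl -conjC -B_eq.
have -> : B - b%:M = invmx P *m (diag_mx d - b%:M) *m P.
  by rewrite mulmxBr mulmxBl -conjC -B_eq.
rewrite -!diag_const_mx -!linearB /=.
set u := const_mx a - d; set v := d - const_mx b.
rewrite !mulmxA mulmxK // -(mulmxA (invmx P) (diag_mx u)) mulmx_diag.
by congr (_ *m diag_mx _ *m _); apply/rowP => i; rewrite !mxE.
Qed.

(** In an orthonormal eigenbasis the form becomes the sum of (M - l_i)(l_i - m)|u_i|^2, with
    nonnegative terms. The spectral theorem is applied over [R[i]], and the sign is carried back
    along the embedding [f]. *)
Lemma spectral_interval_psd (R : rcfType) (n : nat) (A : 'M[R]_n) (m M : R)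
    (x : 'rV[R]_n) :
    A^T = A -> (forall y, y \in eigenvalues A -> m <= y <= M) ->
  0 <= (x *m ((M%:M - A) *m (A - m%:M)) *m x^T) 0 0.
Proof.
move=> A_sym eig_in.
pose f : {rmorphism R -> R[i]} := real_complex R; pose B := map_mx f A.
have B_herm : B \is hermsymmx.
  apply: realsym_hermsym.
    by apply/is_hermitianmxP; rewrite expr0 scale1r map_mx_id // map_trmx A_sym.
  by apply/mxOverP => i j; rewrite mxE /f /= complex_real.
have /mxOverP D_real := hermitian_spectral_diag_real B_herm.
have /hermitian_normalmx/orthomx_spectralP B_eq := B_herm.
have P_unitary : spectralmx B \is unitarymx := spectral_unitarymx B.
set P := spectralmx B in B_eq P_unitary.
set D := spectral_diag B in B_eq D_real.
have P_unit : P \in unitmx by apply: spectral_unit.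
pose l i := complex.Re (D 0 i).
have D_l i : D 0 i = f (l i) by rewrite /l /f /= RRe_real.
(* Each [D 0 i] is a root of the characteristic polynomial of [B], the image under [f] of that of
   [A]; hence its real preimage [l i] is a root of the latter. *)
have l_eig i : l i \in eigenvalues A.
  rewrite -root_prod_XsubC -char_poly_eigenvalues // -(fmorph_root f).
  rewrite map_char_poly -/B B_eq char_poly_conj //.
  rewrite char_poly_trig ?diag_mx_is_trig // rootE horner_prod.
  by rewrite (bigD1 i) //= mxE eqxx mulr1n -D_l !hornerE subrr mul0r.
clearbody P D.
pose u := map_mx f x *m invmx P.
(* [u] holds the coordinates of [x] in the eigenbasis. Since [P] is unitary and [x] is real, the
   right-hand factor is the conjugate transpose of [u], which produces the squared moduli. *)
have uE : P *m map_mx f x^T = u^t*.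
  rewrite /u invmx_unitary // trmx_mul map_mxM.
  rewrite trmxCK; congr (_ *m _).
  by apply/matrixP => i j; rewrite !mxE /f /= conj_Creal ?complex_real.
have mid : map_mx f ((M%:M - A) *m (A - m%:M)) =
    invmx P *m diag_mx (\row_i f ((M - l i) * (l i - m))) *m P.
  have -> : \row_i f ((M - l i) * (l i - m)) =
      \row_i ((f M - D 0 i) * (D 0 i - f m)).
    by apply/rowP => i; rewrite !mxE D_l rmorphM !rmorphB.
  rewrite map_mxM !map_mxB !map_scalar_mx.
  exact: conjmx_diag_shift_mul P_unit B_eq.
rewrite -ler0c -[_%:C%C]/(f _).
set q := (X in f X).
have -> : f q = \sum_i f ((M - l i) * (l i - m)) * `|u 0 i| ^+ 2.
  transitivity ((map_mx f (x *m ((M%:M - A) *m (A - m%:M)) *m x^T)) 0 0).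
    by rewrite mxE.
  rewrite map_mxM map_mxM mid !mulmxA -/u -mulmxA uE mul_mx_diag !mxE.
  by apply: eq_bigr => i _; rewrite !mxE mulrAC mulrC normCK.
apply: sumr_ge0 => i _; rewrite mulr_ge0 ?exprn_ge0 // ler0c.
by have /andP[mi iM] := eig_in _ (l_eig i); rewrite mulr_ge0 ?subr_ge0.
Qed.

Lemma symmetric_spread_bound (R : rcfType) (n : nat) (A : 'M[R]_n) (m M : R)
    (x : 'rV[R]_n) :
    A^T = A -> (forall y, y \in eigenvalues A -> m <= y <= M) ->
  4 * ((x *m x^T) 0 0 * (x *m A *m (x *m A)^T) 0 0 - (x *m A *m x^T) 0 0 ^+ 2)
    <= ((M - m) * (x *m x^T) 0 0) ^+ 2.
Proof.
move=> A_sym /(spectral_interval_psd x A_sym).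
have S_ge0 : 0 <= (x *m x^T) 0 0.
  by rewrite mxE sumr_ge0 // => i _; rewrite mxE -expr2 sqr_ge0.
have -> : x *m ((M%:M - A) *m (A - m%:M)) *m x^T =
    (M + m) *: (x *m A *m x^T) - x *m A *m (x *m A)^T - (M * m) *: (x *m x^T).
  rewrite trmx_mul A_sym mulmxBr mul_mx_scalar mulmxBl mul_scalar_mx.
  rewrite scalerBr scale_scalar_mx !mulmxBr mulmxBl !mulmxA mulmxBl.
  rewrite -!scalemxAr mul_mx_scalar !mulmxBl -!scalemxAl.
  by apply/matrixP => i j; rewrite !mxE; ring.
have entryB (U V : 'M[R]_1) : (U - V) 0 0 = U 0 0 - V 0 0 by rewrite !mxE.
have entryZ c (U : 'M[R]_1) : (c *: U) 0 0 = c * U 0 0 by rewrite mxE.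
rewrite !entryB !entryZ.
move: ((x *m x^T) 0 0) S_ge0 ((x *m A *m x^T) 0 0) => S S_ge0 a.
move: ((x *m A *m (x *m A)^T) 0 0) => b.
move=> /(mulr_ge0 S_ge0) psd; rewrite -subr_ge0.
(* AM-GM for MS - a and a - mS as an exact identity: the square is that of their difference. Scaling
   [psd] by [S] beforehand avoids dividing by [S]. *)
have -> : ((M - m) * S) ^+ 2 - 4 * (S * b - a ^+ 2) =
    (M * S + m * S - 2 * a) ^+ 2 + 4 * (S * ((M + m) * a - b - M * m * S)).
  by ring.
by rewrite addr_ge0 ?sqr_ge0 // mulr_ge0.
Qed.

Theorem corollary26 (R : rcfType) (n : nat) (e : rel 'I_n)
    (e_sym : symmetric e) (e_irr : irreflexive e)
    (no_isolated : forall i : 'I_n, exists j : 'I_n, e i j) :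
  let d : 'I_n -> R := fun i => (degree e i)%:R in
  signless_spread R e ^+ 2 >=
    4 / (\sum_(i < n) d i ^- 2) ^+ 2 *
      ((\sum_(i < n) d i ^- 2) *
         (\sum_(j < n) (1 + \sum_(k < n | e j k) (d k)^-1) ^+ 2)
       - (\sum_(i < n) ((d i)^-1 + \sum_(k < n | e i k) (d i * d k)^-1)) ^+ 2).
Proof.
lazy zeta; set d : 'I_n -> R := fun i => _; set Q := signless_laplacian R e.
have Q_sym : Q^T = Q := signless_laplacian_sym R e_sym.
have d_neq0 i : d i != 0.
  have [j eij] := no_isolated i.
  by rewrite pnatr_eq0 -lt0n; apply/card_gt0P; exists j; rewrite inE.
pose x : 'rV[R]_n := \row_i (d i)^-1.
(* The entries of [x] are chosen so that the degree part of [Q] contributes [(d j)^-1 * d j], which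
   is 1. *)
have xQ j : (x *m Q) 0 j = 1 + \sum_(k < n | e j k) (d k)^-1.
  rewrite mulmxDr mul_mx_diag !mxE mulVf //; congr (_ + _).
  rewrite [RHS]big_mkcond; apply: eq_bigr => k _.
  by rewrite !mxE e_sym; case: (e j k); rewrite ?mulr1 ?mulr0.
have xx : (x *m x^T) 0 0 = \sum_(i < n) d i ^- 2.
  by rewrite mxE; apply: eq_bigr => i _; rewrite !mxE -expr2 exprVn.
have xQQx : (x *m Q *m (x *m Q)^T) 0 0 =
    \sum_(j < n) (1 + \sum_(k < n | e j k) (d k)^-1) ^+ 2.
  by rewrite mxE; apply: eq_bigr => j _; rewrite [_^T _ _]mxE xQ -expr2.
have xQx : (x *m Q *m x^T) 0 0 =
    \sum_(i < n) ((d i)^-1 + \sum_(k < n | e i k) (d i * d k)^-1).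
  rewrite mxE; apply: eq_bigr => i _; rewrite xQ !mxE mulrDl mul1r mulr_suml.
  by congr (_ + _); apply: eq_bigr => k _; rewrite invfM mulrC.
(* The interval is [q_n, q_1], so [M - m] is the spread by definition. *)
have eig_in y := @eigenvalues_bounds R n Q y Q_sym.
have := symmetric_spread_bound x Q_sym eig_in.
rewrite xx xQQx xQx -/(signless_spread R e).
set S := \sum_(i < n) d i ^- 2 => bound.
(* The sum vanishes for [n = 0]; with the convention that 0 has inverse 0, the lower bound is then
   0. *)
have [->|S_neq0] := eqVneq S 0.
  by rewrite expr0n invr0 mulr0 mul0r sqr_ge0.
have S2_gt0 : 0 < S ^+ 2 by rewrite exprn_even_gt0.
by rewrite mulrAC ler_pdivrMr // -exprMn.
Qed.
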